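(* Let $\mathcal{X}$ be a Polish space with its Borel $\sigma$-algebra, and let $\mathcal{P},\mathcal{Q}$ be nonempty, weakly compact, convex sets of Borel probability measures on $\mathcal{X}$. Then $$\max\{\mathrm{KL}(\mathcal{P}\parallel\mathcal{Q}),\mathrm{KL}(\mathcal{Q}\parallel\mathcal{P})\}\ge 2\,V^2(\mathcal{P},\mathcal{Q}).$$
   Context: ''Weakly compact'' means compact in the topology of weak convergence of probability measures. For probability measures $\mu,\nu$: $\mathrm{KL}(\mu\parallel\nu)=\int_{\mathcal{X}}\log\left(\frac{d\mu}{d\nu}\right)d\mu$ (natural logarithm) if $\mu\ll\nu$, and $+\infty$ otherwise; $V(\mu,\nu)=\sup_{A}|\mu(A)-\nu(A)|$ over Borel sets $A$. For sets of probability measures: $\mathrm{KL}(\mathcal{P}\parallel\mathcal{Q}):=\sup_{\mu\in\mathcal{P}}\inf_{\nu\in\mathcal{Q}}\mathrm{KL}(\mu\parallel\nu)$ (extended-real valued), and $V(\mathcal{P},\mathcal{Q}):=\max\left(\sup_{\mu\in\mathcal{P}}\inf_{\nu\in\mathcal{Q}}V(\mu,\nu),\ \sup_{\nu\in\mathcal{Q}}\inf_{\mu\in\mathcal{P}}V(\mu,\nu)\right)$. $V^2(\mathcal{P},\mathcal{Q})$ means $(V(\mathcal{P},\mathcal{Q}))^2$. *)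

(* Defs.v *)
From HB Require Import structures.
From mathcomp Require Import all_boot all_order all_algebra.
From mathcomp Require Import all_classical all_reals all_analysis.

Set Implicit Arguments.
Unset Strict Implicit.
Unset Printing Implicit Defensive.

Import Order.TTheory GRing.Theory Num.Theory.
Import numFieldNormedType.Exports.

Local Open Scope classical_set_scope.
Local Open Scope ring_scope.

Definition is_metric (R : realType) (X : Type) (d : X -> X -> R) : Prop :=
  [/\ forall x y, (d x y = 0) <-> (x = y),
      forall x y, d x y = d y x &
      forall x y z, d x z <= d x y + d y z].

Definition metrizes (R : realType) (X : topologicalType) (d : X -> X -> R)
    : Prop :=
  forall (x : X) (A : set X),
    nbhs x A <-> exists2 e : R, 0 < e & [set y | d x y < e] `<=` A.

Definition complete_metric (R : realType) (X : topologicalType)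
    (d : X -> X -> R) : Prop :=
  forall u : nat -> X,
    (forall e : R, 0 < e ->
       exists N : nat, forall m n : nat,
         (N <= m)%N -> (N <= n)%N -> d (u m) (u n) < e) ->
    exists l : X, u @ \oo --> l.

Definition separable (X : topologicalType) : Prop :=
  exists2 D : set X, countable D & dense D.

Definition polish_space (R : realType) (X : topologicalType) : Prop :=
  separable X /\
  exists d : X -> X -> R, [/\ is_metric d, metrizes d & complete_metric d].

Notation borel X := (g_sigma_algebraType (@open X)).

Notation borel_probability X R := (probability (borel X) R).

Definition bounded_continuous (X : topologicalType) (R : realType) : Type :=
  {f : X -> R | continuous f /\ bounded_fun f}.

(* The coarsest topology on Borel probability measures for which
   [mu |-> \int f dmu] is continuous for every bounded continuous [f]. *)
Definition weak_conv (X : ptopologicalType) (R : realType)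
    : topologicalType :=
  @sup_topology (borel_probability X R) (bounded_continuous X R)
    (fun f => Topological.class (initial_topology
       (fun mu : borel_probability X R => (\int[mu]_x (sval f x))%R : R))).

Definition weakly_compact (X : ptopologicalType) (R : realType)
    (P : set (borel_probability X R)) : Prop :=
  @compact (weak_conv X R) P.

(* A measure of the library is a function on all sets, whose values outside the
   sigma-algebra carry no information; the mixture is therefore only required
   to be represented in [P] up to equality on Borel sets. *)
Definition convex_probabilities (X : ptopologicalType) (R : realType)
    (P : set (borel_probability X R)) : Prop :=
  forall (mu nu : borel_probability X R) (t : R),
    P mu -> P nu -> 0 <= t <= 1 ->
    exists2 rho : borel_probability X R, P rho &
      forall A : set (borel X), measurable A ->
        (rho A = t%:E * mu A + (1 - t)%:E * nu A)%E.

Section divergences.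
Context d (T : measurableType d) (R : realType).
Implicit Types (mu nu : probability T R) (P Q : set (probability T R)).
Local Open Scope ereal_scope.
Local Open Scope charge_scope.

(* The density is only determined [nu]-a.e., and [lne] is [-oo] where it is not
   positive; that set is [mu]-null, so the integral does not see it. *)
Definition KL mu nu : \bar R :=
  if `[< mu `<< nu >] then \int[mu]_x lne (('d (charge_of_finite_measure mu) '/d nu) x) else +oo.

Definition TV mu nu : \bar R :=
  ereal_sup [set `|mu A - nu A| | A in measurable].

Definition KL_sets P Q : \bar R :=
  ereal_sup [set ereal_inf [set KL mu nu | nu in Q] | mu in P].

Definition TV_sets P Q : \bar R :=
  maxe (ereal_sup [set ereal_inf [set TV mu nu | nu in Q] | mu in P])
       (ereal_sup [set ereal_inf [set TV mu nu | mu in P] | nu in Q]).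

End divergences.

(* Main.v *)
Require Import Defs.
From HB Require Import structures.
From mathcomp Require Import all_boot all_order all_algebra.
From mathcomp Require Import all_classical all_reals all_analysis.
From mathcomp Require Import measurable_realfun ring lra.

(** The inequality is Pinsker's inequality [2 TV^2 <= KL] for a single pair of
    measures, carried through the suprema and infima.

    For one pair and one event [A], put [a = mu A] and [b = nu A].  The
    variational lower bound [KL_ge_variational] says that
    [\int g dmu <= KL mu nu] as soon as [\int exp g dnu <= 1].  It is applied to
    [g = l * \1_A - (l * b + l^2 / 8)].  The constraint on [g] is then Hoeffding's
    bound on the exponential moment of a Bernoulli variable of mean [b]
    ([bernoulli_hoeffding]), and [\int g dmu = l * (a - b) - l^2 / 8] is largest at
    [l = 4 * (a - b)], where it equals [2 * (a - b)^2] ([pinsker_event]).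
    Compared with reducing to a two-point space and minimising
    [a ln (a / b) + (1 - a) ln ((1 - a) / (1 - b))], this leaves no degenerate
    cases [a, b = 0, 1] to treat.

    The map [x |-> 2 x^2] is monotone on [[0, +oo]] and commutes with suprema
    there ([sqr_ereal_sup_le]).  This turns the bounds on events into one on
    [TV mu nu], and then into one on the supremum over [mu] of the infimum over
    [nu] ([pinsker_directed]).  As [TV] is symmetric, twice the squares of the two
    one-sided distances in [TV_sets P Q] are bounded by [KL_sets P Q] and
    [KL_sets Q P] respectively. *)

Set Implicit Arguments.
Unset Strict Implicit.
Unset Printing Implicit Defensive.

Import Order.TTheory GRing.Theory Num.Theory.
Import numFieldNormedType.Exports.

Local Open Scope classical_set_scope.
Local Open Scope ring_scope.

(** * Exponential moments of Bernoulli variables *)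

Lemma ge0_of_derive_ge0 (R : realType) (f df : R -> R) :
  (forall x, is_derive x (1 : R) f (df x)) -> f 0 = 0 ->
  (forall x, 0 <= x -> 0 <= df x) -> forall x, 0 <= x -> 0 <= f x.
Proof.
move=> fdf f0 df_ge0 x x_ge0; rewrite -f0.
apply: (@ger0_derive1_ndecry _ f 0) => //.
- move=> y; rewrite in_itv/= andbT => y0.
  by rewrite derive1E (@derive_val _ _ _ _ _ _ _ (fdf y)) df_ge0// ltW.
- apply: derivable_within_continuous => y _; exact: ex_derive.
Qed.

Lemma bernoulli_mgf_gt0 (R : realType) (b l : R) : 0 <= b <= 1 ->
  0 < b * expR l + (1 - b).
Proof.
move=> /andP[b0 b1]; have := expR_gt0 l; move: b0.
rewrite le_eqVlt => /predU1P[<-|b0 e0]; first by lra.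
have : 0 < b * expR l by rewrite mulr_gt0.
by lra.
Qed.

(** The logarithm [f] of the ratio of the two sides vanishes at [0] with its
    derivative, and its second derivative is [1 / 4 - p * (1 - p)], where
    [p = b * expR l / D l] is the mean of the tilted Bernoulli variable; this is
    nonnegative whatever [p] is. *)
Lemma bernoulli_hoeffding_ge0 (R : realType) (b l : R) : 0 <= b <= 1 -> 0 <= l ->
  b * expR l + (1 - b) <= expR (l * b + l ^+ 2 / 8).
Proof.
move=> b01 l0.
pose D (x : R) := b * expR x + (1 - b).
have D_gt0 x : 0 < D x by exact: bernoulli_mgf_gt0.
have D_neq0 x : D x != 0 by rewrite gt_eqF.
have D0 : D 0 = 1 by rewrite /D expR0; ring.
pose f (x : R) := x * b + x ^+ 2 / 8 - ln (D x).
pose f1 (x : R) := b + x / 4 - b * expR x / D x.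
pose f2 (x : R) := 1 / 4 - b * (1 - b) * expR x / D x ^+ 2.
have dD x : is_derive x (1 : R) D (b * expR x).
  by rewrite /D; apply: is_derive_eq; rewrite /GRing.scale/=; ring.
have dlnD x : is_derive x (1 : R) (@ln R \o D) (b * expR x / D x).
  have dl := is_derive1_ln (D_gt0 x).
  by apply: is_derive_eq; rewrite mulrC.
have df x : is_derive x (1 : R) f (f1 x).
  rewrite /f /f1 -[fun x => _]/((fun x => x * b + x ^+ 2 / 8) \- (@ln R \o D)).
  apply: is_derive_eq; rewrite /GRing.scale/=; field.
  exact: D_neq0.
have df1 x : is_derive x (1 : R) f1 (f2 x).
  have dV := is_deriveV (D_neq0 x) (dD x).
  rewrite /f1 -[fun x => _]/((fun x => b + x / 4) \-
    ((fun x => b * expR x) \* (fun x => (D x)^-1))).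
  rewrite /f2; apply: is_derive_eq; rewrite /GRing.scale/=.
  have := D_neq0 x; rewrite /D => H; field.
  exact: H.
have f2_ge0 x : 0 <= f2 x.
  rewrite /f2 subr_ge0 ler_pdivrMr ?exprn_gt0// /D.
  (* arithmetic-geometric mean: 4 * (b * expR x) * (1 - b) <= D x ^+ 2 *)
  have := sqr_ge0 (b * expR x - (1 - b)); nra.
have f_ge0 : 0 <= f l.
  apply: (ge0_of_derive_ge0 df) => //.
    by rewrite /f D0 ln1; lra.
  apply: (ge0_of_derive_ge0 df1) => //.
  by rewrite /f1 D0 expR0; lra.
rewrite -/(D l) -[leLHS]lnK ?posrE// ler_expR.
by move: f_ge0; rewrite /f subr_ge0.
Qed.

(** Negative [l] reduce to positive ones by exchanging the two outcomes. *)
Lemma bernoulli_hoeffding (R : realType) (b l : R) : 0 <= b <= 1 ->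
  b * expR l + (1 - b) <= expR (l * b + l ^+ 2 / 8).
Proof.
move=> b01; have [l0|l0] := leP 0 l; first exact: bernoulli_hoeffding_ge0.
have -> : l * b + l ^+ 2 / 8 = l + ((- l) * (1 - b) + (- l) ^+ 2 / 8) by ring.
have -> : b * expR l + (1 - b) = expR l * ((1 - b) * expR (- l) + (1 - (1 - b))).
  have e : expR l * expR (- l) = 1 by rewrite -expRD subrr expR0.
  by rewrite mulrDr mulrCA e; ring.
rewrite [leRHS]expRD ler_pM2l ?expR_gt0//; apply: bernoulli_hoeffding_ge0; lra.
Qed.

(** * Variational lower bound on the relative entropy *)

Section measure.
Context d (T : measurableType d) (R : realType).
Local Open Scope ereal_scope.
Local Open Scope charge_scope.

(** The positive and negative parts are compared separately; subtraction of
    extended reals is monotone even when an integral is infinite.  This is the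
    form that the logarithm of a density calls for, whose positive part may have
    infinite integral. *)
Lemma ae_le_integral (mu : {measure set T -> \bar R}) (f g : T -> \bar R) :
  measurable_fun setT f -> measurable_fun setT g ->
  {ae mu, forall x, f x <= g x} -> \int[mu]_x f x <= \int[mu]_x g x.
Proof.
move=> mf mg fg; rewrite [leLHS]integralE [leRHS]integralE; apply: leeB.
- apply: ae_ge0_le_integral => //; [exact: measurable_funepos..|].
  apply: filterS fg => x fgx _.
  by apply: (@funepos_le _ _ [set x]); rewrite ?inE// => y /set_mem ->.
- apply: ae_ge0_le_integral => //; [exact: measurable_funeneg..|].
  apply: filterS fg => x fgx _.
  by apply: (@funeneg_le _ _ [set x]); rewrite ?inE// => y /set_mem ->.
Qed.

Lemma measurable_lne_comp (h : T -> \bar R) : (forall x, h x \is a fin_num) ->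
  measurable_fun setT h -> measurable_fun setT (fun x => lne (h x)).
Proof.
move=> hfin mh.
have -> : (fun x => lne (h x)) =
    (fun x => if h x <= 0 then -oo else (ln (fine (h x)))%:E).
  by apply/funext => x; case: (h x) (hfin x).
apply: measurable_fun_ifT => //; first exact: measurable_fun_lee.
apply/measurable_EFinP; apply: measurableT_comp; first exact: measurable_ln.
exact: measurableT_comp.
Qed.

Lemma integral_cst_prob (m : probability T R) (v : \bar R) :
  \int[m]_x v = v.
Proof.
rewrite integral_cst//; transitivity (v * 1); last by rewrite mule1.
by congr (_ * _); exact: probability_setT.
Qed.

(** The density of the charge attached to [mu] may be negative on a null set.
    It is replaced by the everywhere nonnegative, real-valued density of the
    finite measure [mu], which agrees with it almost everywhere for [nu], hence
    for [mu]. *)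
Lemma KL_density (mu nu : probability T R) : mu `<< nu ->
  exists h : T -> R, [/\ measurable_fun setT h, (forall x, 0 <= h x)%R,
    (forall f : T -> \bar R, (forall x, 0 <= f x) -> measurable_fun setT f ->
      \int[mu]_x f x = \int[nu]_x (f x * (h x)%:E)),
    {ae mu, forall x, (0 < h x)%R} &
    KL mu nu = \int[mu]_x lne (h x)%:E].
Proof.
move=> munu; pose k := Radon_Nikodym_SigmaFinite.f mu nu.
have k_ge0 : forall x, 0 <= k x by exact: Radon_Nikodym_SigmaFinite.f_ge0.
have k_fin : forall x, k x \is a fin_num.
  exact: Radon_Nikodym_SigmaFinite.f_fin_num.
have mk : measurable_fun setT k.
  by apply: measurable_int (Radon_Nikodym_SigmaFinite.f_integrable _).
have hE x : (fine (k x))%:E = k x by rewrite fineK.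
have mh : measurable_fun setT (fine \o k) by exact: measurableT_comp.
exists (fine \o k); split => //=.
- by move=> x; rewrite fine_ge0.
- move=> f f0 mf; under [RHS]eq_integral do rewrite hE.
  by rewrite Radon_Nikodym_SigmaFinite.change_of_variables.
- exists [set x | k x <= 0]; split.
  + rewrite -[X in measurable X]setTI.
    exact: emeasurable_fun_infty_c.
  + rewrite (Radon_Nikodym_SigmaFinite.f_integral munu); last first.
      by rewrite -[X in measurable X]setTI; exact: emeasurable_fun_infty_c.
    apply: integral0_eq => x /= kx0; apply/eqP.
    by rewrite eq_le kx0/=; exact: k_ge0.
  + by move=> x /= /negP; rewrite -leNgt -lee_fin hE.
- rewrite /KL asboolT//; apply: ae_eq_integral => //.
  + apply: (@measurable_lne_comp
      ('d (charge_of_finite_measure mu) '/d nu)) => //.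
    by move=> x; exact: Radon_Nikodym_fin_num.
  + apply: (@measurable_lne_comp (EFin \o (fine \o k))) => //.
    exact/measurable_EFinP.
  + have [N [mN N0 kN]] := ae_eq_Radon_Nikodym_SigmaFinite munu measurableT.
    exists N; split => //.
      by move/null_content_dominatesP : munu; apply.
    apply: subset_trans kN => x /= kx kE; apply: kx => _.
    have {}kE := kE Logic.I; rewrite -/k in kE.
    by rewrite -[RHS]/(lne (fine (k x))%:E) hE kE.
Qed.

(** The easy half of the Donsker-Varadhan formula.  With [h] the density, the
    tangent inequality [1 + t <= exp t] at [t = g - ln h] gives
    [g + 1 - exp (g - ln h) <= ln h].  Against [mu], [exp (g - ln h)] has the same
    integral as [h * exp (g - ln h) <= exp g] against [nu]; this integral is thus
    at most [1] and is absorbed by the [1] on the left. *)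
Lemma KL_ge_variational (mu nu : probability T R) (g : T -> R) :
  measurable_fun setT g -> mu.-integrable setT (EFin \o g) ->
  \int[nu]_x (expR (g x))%:E <= 1 -> \int[mu]_x (g x)%:E <= KL mu nu.
Proof.
move=> mg ig g1; have [munu|] := pselect (mu `<< nu); last first.
  by move=> nmunu; rewrite /KL asboolF// leey.
have [h [mh h0 hE hpos ->]] := KL_density munu.
pose e x := expR (g x - ln (h x)).
have me : measurable_fun setT e.
  apply: measurableT_comp; first exact: measurable_expR.
  by apply: measurable_funB => //; exact: measurableT_comp.
have e_le1 : \int[mu]_x (e x)%:E <= 1.
  rewrite hE//; last 2 first.
    by move=> x; rewrite lee_fin expR_ge0.
    by apply/measurable_EFinP.
  apply: le_trans g1; apply: ge0_le_integral => //.
  - by move=> x _; rewrite -EFinM lee_fin mulr_ge0// expR_ge0.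
  - by apply: emeasurable_funM; apply/measurable_EFinP.
  - by apply/measurable_EFinP; apply: measurableT_comp => //; exact: measurable_expR.
  - move=> x _; rewrite -EFinM lee_fin /e.
    (* where the density vanishes, ln 0 = 0 keeps e finite and e * h is 0 *)
    move: (h0 x); rewrite le_eqVlt => /predU1P[<-|hx].
      by rewrite mulr0 expR_ge0.
    by rewrite expRD expRN lnK ?posrE// mulfVK// gt_eqF.
have ie : mu.-integrable setT (EFin \o e).
  apply/integrableP; split; first by apply/measurable_EFinP.
  under eq_integral do rewrite /= ger0_norm ?expR_ge0//.
  by rewrite (le_lt_trans e_le1) ?ltry.
have i1 : mu.-integrable setT (EFin \o cst 1%R).
  exact: finite_measure_integrable_cst.
apply: (@le_trans _ _ (\int[mu]_x (((g x)%:E + 1) - (e x)%:E))).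
  rewrite integralB//; last exact: integrableD.
  rewrite integralD// integral_cst_prob.
  rewrite -addeA leeDl// sube_ge0//.
  by rewrite orbT.
apply: ae_le_integral.
- by apply: emeasurable_funB; [apply: emeasurable_funD|]; apply/measurable_EFinP.
- by apply: (@measurable_lne_comp (EFin \o h)) => //; apply/measurable_EFinP.
apply: filterS hpos => x hx.
rewrite lne_EFin// -[leLHS]/((g x + 1 - e x)%:E) lee_fin lerBlDr.
by have := expR_ge1Dx (g x - ln (h x)); rewrite -/(e x); lra.
Qed.

Lemma pinsker_event (mu nu : probability T R) (A : set T) : measurable A ->
  2%:E * `|mu A - nu A| ^+ 2 <= KL mu nu.
Proof.
move=> mA.
have aE : (fine (mu A))%:E = mu A by rewrite fineK ?fin_num_measure.
have bE : (fine (nu A))%:E = nu A by rewrite fineK ?fin_num_measure.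
set a := fine (mu A) in aE; set b := fine (nu A) in bE.
have b01 : (0 <= b <= 1)%R.
  by rewrite -!lee_fin bE measure_ge0 probability_le1.
rewrite -aE -bE.
(* l maximises l * (a - b) - l ^+ 2 / 8; the constant c makes the exponential
   moment of g under nu at most 1 *)
pose l := (4 * (a - b))%R; pose c := (l * b + l ^+ 2 / 8)%R.
pose g x := (l * \1_A x - c)%R.
have mI : measurable_fun setT (\1_A : T -> R) by exact: measurable_indic.
have mg : measurable_fun setT g.
  by apply: measurable_funB => //; apply: measurable_funM.
have iI (m : probability T R) : m.-integrable setT (EFin \o \1_A).
  exact: integrable_indic.
have ic (m : probability T R) k : m.-integrable setT (EFin \o cst k).
  exact: finite_measure_integrable_cst.
have affine (m : probability T R) (u v : R) :
    \int[m]_x (u * \1_A x + v)%:E = u%:E * m A + v%:E.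
  under eq_integral do rewrite EFinD EFinM.
  rewrite integralD//; [|exact: (integrableZl measurableT u (iI m))|exact: ic].
  rewrite (integralZl measurableT (iI m)) integral_indic// setIT.
  by rewrite integral_cst_prob.
have iZ (m : probability T R) u v :
    m.-integrable setT (EFin \o (fun x => u * \1_A x + v)%R).
  rewrite (_ : _ \o _ = (fun x => u%:E * (\1_A x)%:E) \+ (EFin \o cst v)).
    by apply: integrableD => //; [exact: (integrableZl measurableT u (iI m))|exact: ic].
  by apply/funext => x /=; rewrite EFinD EFinM.
have : \int[mu]_x (g x)%:E <= KL mu nu.
  apply: KL_ge_variational => //; first exact: iZ.
  rewrite (_ : (fun x => _) =
      (fun x => (expR (- c) * (expR l - 1) * \1_A x + expR (- c))%:E)); last first.
    apply/funext => x; congr (_%:E); rewrite /g expRD indicE.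
    by case: (x \in A); rewrite ?mulr1 ?mulr0 ?expR0; ring.
  rewrite affine -bE -EFinM -EFinD lee_fin.
  have /(ler_wpM2l (expR_ge0 (- c))) := bernoulli_hoeffding l b01.
  rewrite -/c -[leRHS]expRD addNr expR0.
  by move=> H; apply: le_trans H; lra.
rewrite affine -aE; apply: le_trans.
rewrite -EFinB abse_EFin -EFin_expe -!EFinM lee_fin real_normK ?num_real//.
by rewrite /c /l; lra.
Qed.

End measure.

(** * Passage to suprema and infima *)

Section sup.
Context (R : realType).
Local Open Scope ereal_scope.

(** The bound on each element says that it lies below [sqrte (K / 2)], a
    condition that passes to the supremum.  Without an element the supremum
    would be [-oo], whose square is [+oo]. *)
Lemma sqr_ereal_sup_le (S : set (\bar R)) (K : \bar R) :
  S !=set0 -> (forall x, S x -> 0 <= x) ->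
  (forall x, S x -> 2%:E * x ^+ 2 <= K) -> 2%:E * ereal_sup S ^+ 2 <= K.
Proof.
move=> [x0 Sx0] S0 SK.
rewrite -lee_pdivlMl//; set r := _ * K.
have Sr x : S x -> x <= sqrte r.
  move=> Sx; have x2r : x ^+ 2 <= r by rewrite lee_pdivlMl//; exact: SK.
  rewrite -(gee0_abs (S0 _ Sx)) -sqrte_sqr lee_sqrt//.
  by rewrite (le_trans _ x2r)// sqre_ge0.
have r0 : 0 <= r.
  by rewrite lee_pdivlMl// mule0 (le_trans _ (SK _ Sx0))// mule_ge0// sqre_ge0.
rewrite -(sqr_sqrte r0) lee_sqr// ?sqrte_ge0//; last first.
  by rewrite (le_trans (S0 _ Sx0))// ereal_sup_ubound.
exact: ge_ereal_sup.
Qed.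

End sup.

Section sets.
Context d (T : measurableType d) (R : realType).
Local Open Scope ereal_scope.
Implicit Types (mu nu : probability T R) (P Q : set (probability T R)).

Lemma TV_ge0 mu nu : 0 <= TV mu nu.
Proof.
apply: (@le_trans _ _ `|mu set0 - nu set0|); first exact: abse_ge0.
by apply: ereal_sup_ubound; exists set0.
Qed.

Lemma TVC mu nu : TV mu nu = TV nu mu.
Proof.
congr ereal_sup; apply/seteqP; split=> _ [A mA <-]; exists A => //=;
  by rewrite -abseN fin_num_oppeB ?fin_num_measure// addeC.
Qed.

Lemma pinsker mu nu : 2%:E * TV mu nu ^+ 2 <= KL mu nu.
Proof.
apply: sqr_ereal_sup_le.
- by exists `|mu set0 - nu set0|, set0.
- by move=> _ [A _ <-]; exact: abse_ge0.
- by move=> _ [A mA <-]; exact: pinsker_event.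
Qed.

Lemma pinsker_directed P Q : P !=set0 ->
  2%:E * ereal_sup [set ereal_inf [set TV mu nu | nu in Q] | mu in P] ^+ 2 <=
  KL_sets P Q.
Proof.
move=> [mu0 Pmu0].
have inf_ge0 mu : 0 <= ereal_inf [set TV mu nu | nu in Q].
  by apply: le_ereal_inf_tmp => _ [nu _ <-]; exact: TV_ge0.
apply: sqr_ereal_sup_le.
- by exists (ereal_inf [set TV mu0 nu | nu in Q]), mu0.
- by move=> _ [mu _ <-].
- move=> _ [mu Pmu <-]; apply: (@le_trans _ _ (ereal_inf [set KL mu nu | nu in Q])).
    apply: le_ereal_inf_tmp => _ [nu Qnu <-].
    apply: le_trans (pinsker mu nu); rewrite lee_pmul2l// lee_sqr ?TV_ge0//.
    by apply: ereal_inf_lbound; exists nu.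
  by apply: ereal_sup_ubound; exists mu.
Qed.

Lemma pinsker_sets P Q : P !=set0 -> Q !=set0 ->
  2%:E * TV_sets P Q ^+ 2 <= maxe (KL_sets P Q) (KL_sets Q P).
Proof.
move=> P0 Q0; rewrite /TV_sets.
have -> : [set ereal_inf [set TV mu nu | mu in P] | nu in Q] =
    [set ereal_inf [set TV nu mu | mu in P] | nu in Q].
  by apply: eq_imagel => nu _; congr ereal_inf; apply: eq_imagel => mu _; exact: TVC.
set x := ereal_sup _; set y := ereal_sup _.
have [xy|/ltW yx] := leP x y; rewrite le_max.
  by rewrite [X in _ || X]pinsker_directed// orbT.
by rewrite pinsker_directed.
Qed.

End sets.

Theorem theorem6 (R : realType) (X : ptopologicalType)
    (polishX : polish_space R X)
    (P Q : set (borel_probability X R))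
    (P_nonempty : P !=set0) (Q_nonempty : Q !=set0)
    (P_compact : weakly_compact P) (Q_compact : weakly_compact Q)
    (P_convex : convex_probabilities P) (Q_convex : convex_probabilities Q) :
  (2%:E * (TV_sets P Q) ^+ 2 <= maxe (KL_sets P Q) (KL_sets Q P))%E.
Proof. exact: pinsker_sets. Qed.
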